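(* Let $(X,\mathcal{A},\mu,T)$ be an ergodic probability-preserving system and $(E_k)_{k\geq1}$ a sequence in $\mathcal{A}$ with $\mu(E_k)>0$ for all $k$ and $\mu(E_k)\to0$. Let $Y\in\mathcal{A}$ with $\mu(Y)>0$, and let $(E_k')_{k\geq1}$ be a sequence of measurable sets with $E_k'\subseteq Y$ such that for every $k\geq1$, points of $Y$ can only reach $E_k$ via $E_k'$. Let $\mathsf{R}$ be any random variable with values in $[0,\infty]$. (a) If $\mu(E_k')\,(\varphi_{E_k}-\varphi_{E_k'})\to0$ in $\mu_Y$-measure as $k\to\infty$, then $\mu(E_k')\to0$, and $$\mu_Y(E_k')\,\varphi^Y_{E_k'}\ \text{converges in law to}\ \mathsf{R}\ \text{on the probability space } (X,\mathcal{A},\mu_Y)$$ holds if and only if $$\mu(E_k')\,\varphi_{E_k}\ \text{converges in law to}\ \mathsf{R}\ \text{on the probability space } (X,\mathcal{A},\mu),$$ as $k\to\infty$. (b) If there exists a constant $M\geq0$ such that $E_k'\subseteq\bigcup_{m=0}^{M}T^{-m}E_k$ for all $k\geq1$, then $\mu(E_k')\,(\varphi_{E_k}-\varphi_{E_k'})\to0$ in $\mu_Y$-measure as $k\to\infty$.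
   Context: A measure preserving transformation $T$ of $(X,\mathcal{A},\mu)$ is a measurable map with $\mu\circ T^{-1}=\mu$ (possibly non-invertible). For $A\in\mathcal{A}$, the first hitting time is $\varphi_A(x):=\min\{n\geq1:T^nx\in A\}$ (with $\min\emptyset=\infty$). For $Y$ with $\mu(Y)>0$, $\mu_Y(B):=\mu(Y\cap B)/\mu(Y)$, the first return map is $T_Y x:=T^{\varphi_Y(x)}x$, and for $E\subseteq Y$ measurable the induced hitting time is $\varphi^Y_E(x):=\inf\{j\geq1: T_Y^j x\in E\}$, $x\in Y$. ''Points of $Y$ can only reach $E$ via $E'$'' means: for every $n\geq0$ and a.e. $x\in Y$, if $T^nx\in E$ then $T^jx\in E'$ for some $j\in\{0,\dots,n\}$. Convergence in law of $[0,\infty)$-valued functions to a $[0,\infty]$-valued $\mathsf{R}$ means convergence of distribution functions at all continuity points $t$ of $t\mapsto\Pr[\mathsf{R}\leq t]$. *)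

(* Defs.v *)
From HB Require Import structures.
From mathcomp Require Import all_boot all_order all_algebra.
From mathcomp Require Import all_classical all_reals all_analysis measurable_realfun.
Set Implicit Arguments. Unset Strict Implicit. Unset Printing Implicit Defensive.
Import Order.TTheory GRing.Theory Num.Theory.
Import numFieldNormedType.Exports.
Local Open Scope classical_set_scope.
Local Open Scope ring_scope.

Definition hitpred {X : Type} (f : X -> X) (A : set X) (x : X) : pred nat :=
  fun n => (0 < n)%N && `[< A (iter n f x) >].

Definition hitn {X : Type} (f : X -> X) (A : set X) (x : X) : option nat :=
  match pselect (exists n, hitpred f A x n) with
  | left ex => Some (ex_minn ex)
  | right _ => None
  end.

Definition hit {R : realType} {X : Type} (f : X -> X) (A : set X) (x : X)
  : \bar R :=
  match hitn f A x with Some n => (n%:R)%:E | None => +oo%E end.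

(* first return map (first_return) T_Y x = T^{phi_Y(x)} x  (x itself when phi_Y(x) = oo,
   a null set by Poincare recurrence) *)
Definition first_return {X : Type} (f : X -> X) (Y : set X) (x : X) : X :=
  match hitn f Y x with Some n => iter n f x | None => x end.

Definition condm {d} {X : measurableType d} {R : realType}
  (mu : set X -> \bar R) (Y : set X) (B : set X) : \bar R :=
  (mu (Y `&` B) * ((fine (mu Y))^-1)%:E)%E.

Definition cvg_law {d} {X : measurableType d} {R : realType}
  (nu : set X -> \bar R) (f : nat -> X -> \bar R)
  {d'} {Om : measurableType d'} (P : set Om -> \bar R) (RV : Om -> \bar R) :=
  forall t : R,
    {for t, continuous (fun s : R => fine (P [set w | (RV w <= s%:E)%E]))} ->
    (fun k => nu [set x | (f k x <= t%:E)%E]) @ \oo -->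
      P [set w | (RV w <= t%:E)%E].

Definition cvg_meas0 {d} {X : measurableType d} {R : realType}
  (nu : set X -> \bar R) (g : nat -> X -> \bar R) :=
  forall eps : R, 0 < eps ->
    (fun k => nu [set x | (eps%:E < `|g k x|)%E]) @ \oo --> 0%E.

Definition reach_only_via {d} {X : measurableType d} {R : realType}
  (mu : {measure set X -> \bar R}) (f : X -> X) (Y E E' : set X) :=
  forall n : nat, {ae mu, forall x, Y x -> E (iter n f x) ->
     exists2 j, (j <= n)%N & E' (iter j f x)}.

Definition measure_preserving {d} {X : measurableType d} {R : realType}
  (mu : {measure set X -> \bar R}) (f : X -> X) :=
  measurable_fun setT f /\
  forall A, measurable A -> mu (f @^-1` A) = mu A.

Definition ergodic {d} {X : measurableType d} {R : realType}
  (mu : {measure set X -> \bar R}) (f : X -> X) :=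
  forall A, measurable A -> f @^-1` A = A -> mu A = 0%E \/ mu A = 1%E.

(* Main.v *)
Require Import Defs.
From HB Require Import structures.
From mathcomp Require Import all_boot all_order all_algebra.
From mathcomp Require Import all_classical all_reals all_analysis measurable_realfun.
From mathcomp Require Import zify ring lra.
Import Order.TTheory GRing.Theory Num.Theory.
Import numFieldNormedType.Exports.
Local Open Scope classical_set_scope.
Local Open Scope ring_scope.

(** Let N be the hitting time of E'_k.  As E'_k lies in Y, the induced hitting time
    is the number of visits to Y among T x, ..., T^N x.  Since N is typically large,
    the ergodic theorem makes this number close to N mu(Y), so the laws of
    mu_Y(E'_k) phi^Y and of mu(E'_k) phi_{E'_k} under mu_Y are close.  The hypothesis
    on the gap replaces phi_{E'_k} by phi_{E_k}.  Finally, the events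
    {mu(E'_k) phi_{E_k} <= t} are almost T-invariant as mu(E_k) -> 0, hence
    asymptotically independent of Y, so that mu_Y may be replaced by mu.

    Convergence in measure in the ergodic theorem, for indicators of sets, is
    enough; it is obtained from a tiling argument (Katznelson-Weiss) applied to the
    exactly invariant set where sup_n (S_n - a n) is infinite. *)

(** * Visits and hitting times *)

(** Times start at 0, so [visits f Z n (f x)] counts the visits at times 1 to [n], the range in
    which [hitn] searches. *)
Definition visits {X : Type} (f : X -> X) (Z : set X) (n : nat) (x : X) : nat :=
  (\sum_(i < n) `[< Z (iter i f x) >])%N.

Section Hitting.
Context {X : Type} (f : X -> X).
Implicit Types (Z A Y : set X) (x : X) (m n : nat).

Lemma visits0 Z x : visits f Z 0 x = 0%N.
Proof. by rewrite /visits big_ord0. Qed.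

Lemma visitsS Z n x : visits f Z n.+1 x = (`[< Z x >] + visits f Z n (f x))%N.
Proof.
rewrite /visits big_ord_recl /=; congr addn; apply: eq_bigr => i _.
by rewrite -iterSr.
Qed.

Lemma visitsD Z m n x :
  visits f Z (m + n) x = (visits f Z m x + visits f Z n (iter m f x))%N.
Proof.
elim: m x => [|m IH] x; first by rewrite visits0.
by rewrite addSn !visitsS IH addnA -iterSr.
Qed.

Lemma leq_visits Z n x : (visits f Z n x <= n)%N.
Proof.
elim: n x => [|n IH] x; first by rewrite visits0.
by rewrite visitsS -add1n leq_add ?leq_b1.
Qed.

Lemma visits_mono Z m n x : (m <= n)%N -> (visits f Z m x <= visits f Z n x)%N.
Proof. by move=> /subnKC <-; rewrite visitsD leq_addr. Qed.

Lemma visits_subset Z A n x : Z `<=` A -> (visits f Z n x <= visits f A n x)%N.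
Proof.
move=> ZA; apply: leq_sum => i _; case: asboolP => // Zx.
by case: asboolP => // /(_ (ZA _ Zx)).
Qed.

Lemma visits_setC Z n x : (visits f Z n x + visits f (~` Z) n x)%N = n.
Proof.
elim: n x => [|n IH] x; first by rewrite !visits0.
rewrite !visitsS addnACA IH.
by rewrite (_ : `[< (~` Z) x >] = ~~ `[< Z x >]) ?asbool_neg//; case: asbool.
Qed.

Lemma visits_gt0 Z n x :
  (0 < visits f Z n x)%N -> exists2 i, (i < n)%N & Z (iter i f x).
Proof.
elim: n x => [|n IH] x; first by rewrite visits0.
rewrite visitsS; case: asboolP => [Zx _|_]; first by exists 0%N.
by rewrite add0n => /IH[i lin Zi]; exists i.+1 => //; rewrite iterSr.
Qed.

Variant hitn_spec A x : option nat -> Prop :=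
  | HitnSome n of (0 < n)%N & A (iter n f x) &
      (forall m, (0 < m)%N -> A (iter m f x) -> (n <= m)%N) : hitn_spec A x (Some n)
  | HitnNone of (forall m, (0 < m)%N -> ~ A (iter m f x)) : hitn_spec A x None.

Lemma hitnP A x : hitn_spec A x (hitn f A x).
Proof.
rewrite /hitn; case: pselect => [ex|nex].
  case: ex_minnP => n /andP[n0 /asboolP An] nmin; constructor => // m m0 Am.
  by apply: nmin; rewrite /hitpred m0; apply/asboolP.
constructor => m m0 Am; apply: nex; exists m; rewrite /hitpred m0.
exact/asboolP.
Qed.

(** The first return is the only visit to [Y] at times 1 to [m], so visit counts can be split there
    in the two inductions below. *)
Lemma first_returnE Y n x : (0 < n)%N -> Y (iter n f x) ->
  exists m, [/\ (0 < m <= n)%N, first_return f Y x = iter m f x, Y (iter m f x) &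
    visits f Y m (f x) = 1%N].
Proof.
move=> n0 Yn; rewrite /first_return.
case: (hitnP Y x) => [m m0 Ym mmin|/(_ n n0)//].
exists m; split => //; first by rewrite m0 mmin.
case: m m0 Ym mmin => // m _ Ym mmin.
rewrite -addn1 visitsD visitsS visits0 addn0 -iterSr.
rewrite asboolT//.
case: (posnP (visits f Y m (f x))) => [-> //|].
move=> /visits_gt0[i im]; rewrite -iterSr => /mmin; lia.
Qed.

(** Each visit to [Y] is one step of the return map; strong induction splits off the first one.
    Hence a hit at time [n] is an induced hit at the number of visits, and the default value of
    [first_return] never occurs. *)
Lemma iter_first_return_visits Y n x : (0 < n)%N -> Y (iter n f x) ->
  (0 < visits f Y n (f x))%N /\
  iter (visits f Y n (f x)) (first_return f Y) x = iter n f x.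
Proof.
elim/ltn_ind: n x => n IH x n0 Yn.
have [m [/andP[m0 mn] xm Ym vm]] := first_returnE Y n x n0 Yn.
have -> : visits f Y n (f x) = (1 + visits f Y (n - m) (f (iter m f x)))%N.
  by rewrite -{1}(subnKC mn) visitsD vm -iterSr iterS.
split => //; have [nm0|nm0] := posnP (n - m)%N.
  rewrite nm0 visits0 addn0 /= xm; congr iter; lia.
have nmn : (n - m < n)%N by lia.
have Ynm : Y (iter (n - m) f (iter m f x)) by rewrite -iterD subnK.
have [_] := IH (n - m)%N nmn (iter m f x) nm0 Ynm.
rewrite -iterD subnK// => <-.
by rewrite add1n iterSr xm -iterS.
Qed.

(** The converse translation: with at least [j] visits up to time [m], the first [j] steps of the
    return map are genuine returns and use at most [m] steps of [f]. *)
Lemma iter_first_returnP Y m j x : (0 < j <= visits f Y m (f x))%N ->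
  exists2 i, (0 < i <= m)%N & iter j (first_return f Y) x = iter i f x.
Proof.
elim: j m x => // j IH m x /andP[_ jm].
have [n nm] := visits_gt0 _ _ _ (leq_ltn_trans (leq0n j) jm).
rewrite -iterSr => Yn.
have [p [/andP[p0 pn] xp Yp vp]] := first_returnE Y n.+1 x isT Yn.
have pm : (p <= m)%N := leq_trans pn nm.
have [->|j0] := posnP j; first by exists p; rewrite ?p0.
move: jm; rewrite -{1}(subnKC pm) visitsD vp -iterSr iterS add1n ltnS => jm.
have [|i /andP[i0 im] ji] := IH (m - p)%N (iter p f x); first by rewrite j0.
exists (i + p)%N; first lia.
by rewrite iterSr xp ji iterD.
Qed.

End Hitting.

(** * Hitting times in extended reals as existence of visits *)

Section ScaledHit.
Context {R : realType} {X : Type} (f : X -> X).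

(** Positivity of [c] keeps [c * +oo] infinite; for [c = 0] the product is 0 even at points that
    never hit, a case treated separately wherever it can arise. *)
Lemma scaled_hit_leP (c t : R) A x : 0 < c ->
  (c%:E * hit f A x <= t%:E)%E <->
  exists i, [/\ (0 < i)%N, c * i%:R <= t & A (iter i f x)].
Proof.
move=> c0; rewrite /hit; case: (hitnP f A x) => [n n0 An nmin|nA].
  rewrite -EFinM lee_fin; split; first by exists n.
  by move=> [i [i0 it /nmin-/(_ i0) ni]]; apply: le_trans it; rewrite ler_pM2l// ler_nat.
rewrite gt0_muley ?lte_fin//; split => //.
by move=> [i [i0 _ /nA]]; case.
Qed.

Lemma hit_leP n A x : (hit f A x <= n%:R%:E :> \bar R)%E <->
  exists2 i, (0 < i <= n)%N & A (iter i f x).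
Proof.
rewrite -[hit f A x]mul1e scaled_hit_leP//; split.
  by move=> [i [i0 + Ai]]; rewrite mul1r ler_nat => ni; exists i; rewrite ?i0.
by move=> [i /andP[i0 ni] Ai]; exists i; rewrite mul1r ler_nat.
Qed.

Lemma hit_finP A x : (exists2 n, (0 < n)%N & hit f A x = n%:R%:E :> \bar R) \/
  hit f A x = +oo%E :> \bar R.
Proof.
by rewrite /hit; case: (hitnP f A x) => [n n0 _ _|_]; [left; exists n|right].
Qed.

End ScaledHit.

(** * Probabilities and measurability *)

Definition prob {R : realType} {d : measure_display} {X : measurableType d}
  (mu : probability X R) (A : set X) : R := fine (mu A).

Section Prob.
Context {R : realType} {d : measure_display} {X : measurableType d}.
Variable mu : probability X R.
Implicit Types A B : set X.

Lemma probE A : measurable A -> mu A = (prob mu A)%:E.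
Proof. by move=> mA; rewrite /prob fineK// fin_num_measure. Qed.

Lemma prob_ge0 A : 0 <= prob mu A.
Proof. exact: fine_ge0. Qed.

Lemma prob_subset A B : measurable A -> measurable B -> A `<=` B ->
  prob mu A <= prob mu B.
Proof. by move=> mA mB AB; rewrite -lee_fin -!probE// le_measure ?inE. Qed.

Lemma prob_setT : prob mu setT = 1.
Proof. by rewrite /prob probability_setT. Qed.

Lemma prob_le1 A : measurable A -> prob mu A <= 1.
Proof. by move=> mA; rewrite -prob_setT prob_subset. Qed.

Lemma prob_setC A : measurable A -> prob mu (~` A) = 1 - prob mu A.
Proof. by move=> mA; rewrite /prob probability_setC// probE. Qed.

Lemma prob_setU A B : measurable A -> measurable B ->
  prob mu (A `|` B) <= prob mu A + prob mu B.
Proof.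
move=> mA mB; rewrite -lee_fin EFinD -!probE//; last exact: measurableU.
exact: measureU2.
Qed.

Lemma prob_setDI A B : measurable A -> measurable B ->
  prob mu A = prob mu (A `\` B) + prob mu (A `&` B).
Proof.
move=> mA mB; apply: EFin_inj; rewrite EFinD -!probE//; first exact: measureDI.
- exact: measurableI.
- exact: measurableD.
Qed.

Lemma prob_subsetU A B C : measurable A -> measurable B -> measurable C ->
  A `<=` B `|` C -> prob mu A <= prob mu B + prob mu C.
Proof.
move=> mA mB mC ABC; apply: le_trans (prob_setU _ _ mB mC).
by apply: prob_subset => //; apply: measurableU.
Qed.

Lemma cvg_prob0P (A : nat -> set X) : (forall n, measurable (A n)) ->
  (mu (A n) @[n --> \oo] --> 0%E) <->
  (forall eps, 0 < eps -> \forall n \near \oo, prob mu (A n) < eps).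
Proof.
move=> mA; have -> : (fun n => mu (A n)) = (fun n => (prob mu (A n))%:E).
  by apply/funext => n; rewrite probE.
split=> [/fine_cvgP[_ /cvgr0Pnorm_lt h] eps /h|h].
  by apply: filterS => n /=; rewrite ger0_norm ?prob_ge0.
apply/fine_cvgP; split; first by apply: nearW.
apply/cvgr0Pnorm_lt => e /h; apply: filterS => n /=.
by rewrite ger0_norm ?prob_ge0.
Qed.

End Prob.

(** * Measurability of visit counts, hitting times and the return map *)

Section MeasurableIter.
Context {d : measure_display} {X : measurableType d}.
Variable (T : X -> X).
Hypothesis mT : measurable_fun setT T.
Implicit Types A Z : set X.

Lemma measurable_preimage_iter n A : measurable A -> measurable (iter n T @^-1` A).
Proof.
move=> mA; elim: n => [//|n IH].
rewrite (_ : _ @^-1` _ = T @^-1` (iter n T @^-1` A)).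
  by rewrite -[X in measurable X]setTI; apply: mT.
by apply/seteqP; split=> x; rewrite /preimage/= -iterSr.
Qed.

Lemma measurable_visits Z n (P : nat -> Prop) : measurable Z ->
  measurable [set x | P (visits T Z n x)].
Proof.
move=> mZ; elim: n P => [|n IH] P.
  have [p|p] := pselect (P 0%N).
    by rewrite (_ : [set _ | _] = setT)//; apply/seteqP; split=> x //=; rewrite visits0.
  by rewrite (_ : [set _ | _] = set0)//; apply/seteqP; split=> x //=; rewrite visits0.
rewrite (_ : [set _ | _] =
  (Z `&` (iter 1 T @^-1` [set x | P (1 + visits T Z n x)%N])) `|`
  (~` Z `&` (iter 1 T @^-1` [set x | P (visits T Z n x)%N]))).
  apply: measurableU; apply: measurableI => //.
  - exact: measurable_preimage_iter (IH (fun k => P (1 + k)%N)).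
  - exact: measurableC.
  - exact: measurable_preimage_iter (IH P).
apply/seteqP; split=> x /=; rewrite visitsS.
  by have [Zx|nZx] := pselect (Z x); [rewrite asboolT|rewrite asboolF] => //; [left|right].
by move=> [][Zx]; [rewrite asboolT|rewrite asboolF].
Qed.

(** The option has countably many values, each with a measurable level set, so any predicate of it
    defines a measurable set. *)
Lemma measurable_hitn A (P : option nat -> Prop) : measurable A ->
  measurable [set x | P (hitn T A x)].
Proof.
move=> mA.
have mC n : measurable (~` (iter n T @^-1` A)).
  exact/measurableC/measurable_preimage_iter.
pose H n := (iter n T @^-1` A) `&`
  \bigcap_(m in [set m | (0 < m < n)%N]) ~` (iter m T @^-1` A).
pose N := \bigcap_(m in [set m | (0 < m)%N]) ~` (iter m T @^-1` A).
rewrite (_ : [set _ | _] =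
  (\bigcup_(n in [set n | (0 < n)%N /\ P (Some n)]) H n) `|` ([set _ | P None] `&` N)).
  apply: measurableU.
    apply: bigcup_measurable => n _; apply: measurableI.
      exact: measurable_preimage_iter.
    exact: bigcap_measurableType.
  apply: measurableI; last exact: bigcap_measurableType.
  have [p|p] := pselect (P None).
    by rewrite (_ : [set _ | _] = setT)//; apply/seteqP; split.
  by rewrite (_ : [set _ | _] = set0)//; apply/seteqP; split.
apply/seteqP; split=> x /=; case: (hitnP T A x) => [n n0 An nmin|nA] => //.
- move=> Pn; left; exists n => //; split => // m /= /andP[m0 mn] Am.
  by have := nmin m m0 Am; rewrite leqNgt mn.
- by move=> PN; right.
- case=> [[m [m0 Pm] [Am mmin]]|[_ /(_ n n0)]//].
  suff -> : n = m by [].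
  apply/eqP; rewrite eqn_leq nmin//= leqNgt; apply/negP => nm.
  by apply: (mmin n) => //=; rewrite n0.
- by case=> [[m [m0 Pm] [/(nA m m0)]]|[]].
Qed.

Lemma measurable_hit {R : realType} A : measurable A ->
  measurable_fun setT (hit T A : X -> \bar R).
Proof.
move=> mA _ B _; rewrite setTI.
exact: (measurable_hitn A (fun o => B (if o is Some n then n%:R%:E else +oo%E))).
Qed.

Lemma measurable_first_return A : measurable A ->
  measurable_fun setT (first_return T A).
Proof.
move=> mA _ B mB; rewrite setTI.
rewrite (_ : _ @^-1` _ =
  (\bigcup_n ([set x | hitn T A x = Some n] `&` iter n T @^-1` B)) `|`
  ([set x | hitn T A x = None] `&` B)).
  apply: measurableU; last first.
    by apply: measurableI => //; exact: (measurable_hitn A (fun o => o = None)).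
  apply: bigcup_measurable => n _; apply: measurableI.
    exact: (measurable_hitn A (fun o => o = Some n)).
  exact: measurable_preimage_iter.
apply/seteqP; split=> x; rewrite /preimage/= /first_return.
  by case E: (hitn T A x) => [n|] Bx; [left; exists n => //; split|right; split].
by case=> [[n _ [->]]|[->]].
Qed.

End MeasurableIter.

(** * Mean visit counts under an invariant measure *)

Section Preserving.
Context {R : realType} {d : measure_display} {X : measurableType d}.
Variables (mu : probability X R) (T : X -> X).
Hypothesis mpT : measure_preserving mu T.
Implicit Types A B Z : set X.

Lemma prob_preimage_iter n A : measurable A ->
  prob mu (iter n T @^-1` A) = prob mu A.
Proof.
move=> mA; elim: n => [//|n IH].
rewrite (_ : _ @^-1` _ = T @^-1` (iter n T @^-1` A)).
  rewrite -{}IH /prob mpT.2//; exact: measurable_preimage_iter mpT.1 _ _ _.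
by apply/seteqP; split=> x; rewrite /preimage/= -iterSr.
Qed.

(** Integrate the lower bound over [A]: the integral of the visit count is the sum of the measures
    of [A] intersected with the preimages of [Z]. *)
Lemma le_sum_visits (K : R) n A Z : 0 <= K -> measurable A -> measurable Z ->
  (forall x, A x -> K <= (visits T Z n x)%:R) ->
  K * prob mu A <= \sum_(j < n) prob mu (A `&` (iter j T @^-1` Z)).
Proof.
move=> K0 mA mZ KA.
have mTZ (j : nat) : measurable (iter j T @^-1` Z) by exact: measurable_preimage_iter mpT.1 _ _ _.
rewrite -lee_fin EFinM -probE// -integral_cst// -sumEFin.
under eq_bigr => j _.
  rewrite -probE; last exact: measurableI.
  rewrite setIC -integral_indic//; over.
have mf (j : 'I_n) : measurable_fun A (fun x => (\1_(iter j T @^-1` Z) x : R)%:E).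
  apply/measurable_EFinP; apply: measurable_funTS; exact: measurable_indic.
rewrite -ge0_integral_sum//.
apply: ge0_le_integral => //.
  exact: emeasurable_sum.
move=> x Ax; rewrite sumEFin lee_fin; apply: (le_trans (KA x Ax)).
rewrite /visits natr_sum; apply: ler_sum => j _.
by rewrite indicE; case: asboolP => Zx; rewrite ?ler0n// mem_set.
Qed.

Lemma le_visits (K : R) n Z : 0 <= K -> measurable Z ->
  (forall x, K <= (visits T Z n x)%:R) -> K <= n%:R * prob mu Z.
Proof.
move=> K0 mZ KZ; have := le_sum_visits K n setT Z K0 measurableT mZ (fun x _ => KZ x).
rewrite prob_setT mulr1 => /le_trans; apply.
under eq_bigr => j _ do rewrite setTI prob_preimage_iter//.
by rewrite sumr_const card_ord mulr_natl.
Qed.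

End Preserving.

(** * The ergodic theorem in measure for indicators *)

Section Ergodic.
Context {R : realType} {d : measure_display} {X : measurableType d}.
Variables (mu : probability X R) (T : X -> X).
Hypothesis mpT : measure_preserving mu T.
Implicit Types (Z : set X) (a b : R).

Definition slow_visits Z a (M : nat) : set X :=
  [set x | forall n, (0 < n <= M)%N -> (visits T Z n x)%:R <= a * n%:R].

(** Moving the starting point one step changes the excess by a bounded amount. Unboundedness
    therefore defines a set equal to its own preimage, as [ergodic] requires. *)
Definition unbounded_excess Z a : set X :=
  [set x | forall C : nat, exists n, C%:R < (visits T Z n x)%:R - a * n%:R].

Lemma measurable_slow_visits Z a M : measurable Z -> measurable (slow_visits Z a M).
Proof.
move=> mZ; rewrite (_ : slow_visits Z a M = \bigcap_(n in [set n | (0 < n <= M)%N])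
    [set x | (visits T Z n x)%:R <= a * n%:R]).
  by apply: bigcap_measurableType => n _;
    exact: (measurable_visits T mpT.1 Z n (fun v => v%:R <= a * n%:R)).
by apply/seteqP; split.
Qed.

Lemma measurable_unbounded_excess Z a : measurable Z ->
  measurable (unbounded_excess Z a).
Proof.
move=> mZ; rewrite (_ : unbounded_excess Z a = \bigcap_(C : nat) \bigcup_(n : nat)
    [set x | C%:R < (visits T Z n x)%:R - a * n%:R]).
  apply: bigcap_measurableType => C _; apply: bigcup_measurable => n _.
  exact: (measurable_visits T mpT.1 Z n (fun v => C%:R < v%:R - a * n%:R)).
apply/seteqP; split=> x h C; last by have [n _ hn] := h C I; exists n.
by move=> _; have [n hn] := h C; exists n.
Qed.

(* Greedy tiling of {0, ..., L-1}: from a point outside [slow_visits] jump over a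
   block of length at most M with more than a proportion a of visits; every other
   point counts as a visit by itself. *)
Lemma visits_tiling Z a M L x : 0 <= a <= 1 ->
  a * (L%:R - M%:R) <= (visits T (Z `|` slow_visits Z a M) L x)%:R.
Proof.
move=> /andP[a0 a1]; elim/ltn_ind: L x => L IH x.
have [LM|ML] := leqP L M.
  by rewrite (le_trans _ (ler0n _ _))// mulr_ge0_le0// subr_le0 ler_nat.
have [sx|] := pselect (slow_visits Z a M x).
  case: L IH ML => // L IH ML; rewrite visitsS asboolT; last by right.
  have := IH L (ltnSn L) (T x); rewrite -[L.+1]addn1 !natrD /=; lra.
move=> /existsNP[n /not_implyP[/andP[n0 nM] /negP]]; rewrite -ltNge => an.
have nL : (n <= L)%N by lia.
have Ln : (L - n < L)%N by lia.
rewrite -(subnKC nL) visitsD; have := IH _ Ln (iter n T x).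
have : (visits T Z n x)%:R <= (visits T (Z `|` slow_visits Z a M) n x)%:R :> R.
  by rewrite ler_nat; apply: visits_subset; exact: subsetUl.
by rewrite !natrD; lra.
Qed.

(** If the excess is unbounded almost everywhere, slow points become rare as [M] grows. Integrating
    the tiling bound over a long stretch [L] gives [a * (L - M) <= L * (prob mu Z + e / 2)];
    division by [L] loses another [e / 2]. *)
Lemma excess_prob_ge Z a : measurable Z -> 0 <= a <= 1 ->
  mu (unbounded_excess Z a) = 1%E -> a <= prob mu Z.
Proof.
move=> mZ /andP[a0 a1] Z1.
have mS := measurable_slow_visits Z a ^~ mZ.
have S0 : mu (slow_visits Z a M) @[M --> \oo] --> 0%E.
  suff -> : 0%E = mu (\bigcap_M slow_visits Z a M).
    apply: nonincreasing_cvg_mu => //.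
    - by rewrite ltey_eq fin_num_measure.
    - exact: bigcap_measurableType.
    - move=> m n mn; apply/subsetPset => x h p /andP[p0 pm]; apply: h.
      by rewrite p0 (leq_trans pm).
  (* A point that is slow for every [M] never has positive excess, so it violates the definition of
     [unbounded_excess] at [C = 0]. *)
  apply/esym/(@subset_measure0 _ _ _ mu _ (~` unbounded_excess Z a)).
  - exact: bigcap_measurableType.
  - exact/measurableC/measurable_unbounded_excess.
  - move=> x h /(_ 0%N)[n]; rewrite ltNge subr_le0 => /negP; apply.
    case: n => [|n]; first by rewrite visits0 mulr0.
    by apply: (h n.+1 I); rewrite leqnn.
  - suff : mu (~` unbounded_excess Z a) = 0%E by [].
    by rewrite probability_setC ?Z1 ?subee//; exact: measurable_unbounded_excess.
apply/ler_addgt0Pr => e e0; have e2 : 0 < e / 2 by lra.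
have /(_ _ e2)[M _ /(_ M (leqnn M))/= SM] := (cvg_prob0P mu _ mS).1 S0.
pose L := (Num.truncn (M%:R / (e / 2))).+1.
have LM : M%:R < e / 2 * L%:R by rewrite mulrC -ltr_pdivrMr// truncnS_gt.
(* If [L < M], then [M < e / 2 * L] forces [e > 2], and the claim follows from [a <= 1]. *)
have [LM'|ML] := leqP M L; last first.
  have : (L%:R <= M%:R :> R) by rewrite ler_nat ltnW.
  have : prob mu Z >= 0 by exact: prob_ge0.
  have : 1 <= L%:R :> R by rewrite ler1n.
  nra.
have K0 : 0 <= a * (L%:R - M%:R) by rewrite mulr_ge0// subr_ge0 ler_nat.
have mU : measurable (Z `|` slow_visits Z a M) by exact: measurableU.
have a01 : 0 <= a <= 1 by rewrite a0.
have := le_visits mu T mpT _ L _ K0 mU (fun x => visits_tiling Z a M L x a01).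
have U : prob mu (Z `|` slow_visits Z a M) <= prob mu Z + e / 2.
  by apply: le_trans (prob_setU _ _ _ mZ (mS M)) _; lra.
have L0 : 0 < L%:R :> R by rewrite ltr0n.
move=> h.
have : a * L%:R <= L%:R * (prob mu Z + e / 2) + M%:R.
  have : L%:R * prob mu (Z `|` slow_visits Z a M) <= L%:R * (prob mu Z + e / 2).
    by rewrite ler_pM2l.
  have : a * M%:R <= M%:R by rewrite ler_piMl.
  lra.
by move=> aL; rewrite -(ler_pM2r L0); lra.
Qed.

Hypothesis erT : ergodic mu T.

Lemma unbounded_excess_preimage Z a :
  T @^-1` unbounded_excess Z a = unbounded_excess Z a.
Proof.
(* One step changes the count by at most 1 and the term [a * n] by less than [B]; hence the levels
   [C + B] and [C + B.+1] below. *)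
pose B := (Num.truncn `|a|).+1.
have aB : `|a| < B%:R by exact: truncnS_gt.
have [a1 a2] : a < B%:R /\ - a < B%:R by split; apply: le_lt_trans aB; rewrite ?ler_norm// -normrN ler_norm.
clearbody B; apply/seteqP; split=> x h C.
- have [n hn] := h (C + B)%N; exists n.+1; move: hn.
  rewrite visitsS !natrD -natr1 => hn.
  have : 0 <= (`[< Z x >] : nat)%:R :> R by rewrite ler0n.
  lra.
- have [[|n]] := h (C + B.+1)%N.
    by rewrite visits0 mulr0 subr0 ltr_nat ltn0.
  rewrite visitsS !natrD -!natr1 => hn; exists n.
  have : (`[< Z x >] : nat)%:R <= 1 :> R by rewrite lern1 leq_b1.
  lra.
Qed.

Lemma unbounded_excess_null Z a : measurable Z -> 0 <= a <= 1 -> prob mu Z < a ->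
  mu (unbounded_excess Z a) = 0%E.
Proof.
move=> mZ a01 Za.
have [//|/(excess_prob_ge Z a mZ a01)] :=
  @erT _ (measurable_unbounded_excess Z a mZ) (unbounded_excess_preimage Z a).
by rewrite leNgt Za.
Qed.

(** Above the slope [a], halfway between the mean and the target [b], the excess is almost surely
    bounded. Up to probability [eps] one constant [C] bounds it for all [n], and the slope
    difference [eta / 2] outgrows [C]. *)
Lemma visits_upper Z eta : measurable Z -> 0 < eta -> forall eps, 0 < eps ->
  \forall n \near \oo,
    prob mu [set x | n%:R * (prob mu Z + eta) < (visits T Z n x)%:R] < eps.
Proof.
move=> mZ eta0 eps eps0; set b := prob mu Z + eta.
have pZ0 := prob_ge0 mu Z.
(* A slope of at least 1 is never exceeded; below 1 the slope [a] lies in the range that the tiling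
   allows. *)
have [b1|b1] := leP 1 b.
  near=> n; rewrite (_ : [set _ | _] = set0) /prob ?measure0//.
  apply/seteqP; split=> x //=; rewrite ltNge => /negP; apply.
  have := leq_visits T Z n x; rewrite -(ler_nat R) => /le_trans; apply.
  by rewrite ler_peMr.
pose a := prob mu Z + eta / 2.
have a01 : 0 <= a <= 1 by rewrite /a; apply/andP; move: b1; rewrite /b; lra.
have Za : prob mu Z < a by rewrite /a; lra.
pose F (C : nat) := [set x | exists n, C%:R < (visits T Z n x)%:R - a * n%:R].
have mF C : measurable (F C).
  rewrite (_ : F C = \bigcup_(n : nat) [set x | C%:R < (visits T Z n x)%:R - a * n%:R]).
    apply: bigcup_measurable => n _.
    exact: (measurable_visits T mpT.1 Z n (fun v => C%:R < v%:R - a * n%:R)).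
  by apply/seteqP; split=> x [n]; exists n.
have F0 : mu (F C) @[C --> \oo] --> 0%E.
  rewrite -(unbounded_excess_null Z a)//.
  have -> : unbounded_excess Z a = \bigcap_C F C.
    by apply/seteqP; split=> x h C; [move=> _; exact: h|exact: (h C I)].
  apply: nonincreasing_cvg_mu => //.
  - by rewrite ltey_eq fin_num_measure.
  - exact: bigcap_measurableType.
  - move=> m n mn; apply/subsetPset => x [p hp]; exists p; apply: le_lt_trans hp.
    by rewrite ler_nat.
have /(_ _ eps0)[C _ /(_ C (leqnn C))/= FC] := (cvg_prob0P mu _ mF).1 F0.
near=> n; apply: le_lt_trans FC; apply: prob_subset => //.
  exact: (measurable_visits T mpT.1 Z n (fun v => n%:R * b < v%:R)).
move=> x /= nb; exists n; have : C%:R <= n%:R * (eta / 2) :> R.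
  rewrite -ler_pdivrMr; last lra.
  by near: n; exact: nbhs_infty_ger.
move: nb; rewrite /a /b; lra.
Unshelve. all: by end_near. Qed.

(** Too few visits to [Z] are too many visits to its complement. *)
Lemma visits_lower Z eta : measurable Z -> 0 < eta -> forall eps, 0 < eps ->
  \forall n \near \oo,
    prob mu [set x | (visits T Z n x)%:R < n%:R * (prob mu Z - eta)] < eps.
Proof.
move=> mZ eta0 eps eps0.
apply: filterS (visits_upper (~` Z) eta (measurableC mZ) eta0 eps eps0) => n.
rewrite prob_setC//; congr (prob mu _ < _).
apply/seteqP; split => x /=; have /(congr1 (fun k => k%:R : R)) := visits_setC T Z n x;
  rewrite natrD; lra.
Qed.

End Ergodic.

(** * Almost invariant events and hitting times *)

Section HittingTimes.
Context {R : realType} {d : measure_display} {X : measurableType d}.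
Variables (mu : probability X R) (T : X -> X).
Hypothesis mpT : measure_preserving mu T.
Implicit Types (A E Z : set X).

Lemma measurable_hit_le E n : measurable E ->
  measurable [set x | (hit T E x <= n%:R%:E :> \bar R)%E].
Proof.
move=> mE; rewrite -[X in measurable X]setTI.
exact/emeasurable_fun_infty_c/measurable_hit/mE/mpT.1.
Qed.

Lemma measurable_scaled_hit_le (S : X -> X) E c t : measurable_fun setT S ->
  measurable E -> measurable [set x | (c%:E * hit S E x <= t%:E :> \bar R)%E].
Proof.
move=> mS mE; rewrite -[X in measurable X]setTI.
exact/emeasurable_fun_infty_c/measurable_funeM/measurable_hit/mE/mS.
Qed.

Lemma prob_hit_le E n : measurable E ->
  prob mu [set x | (hit T E x <= n%:R%:E :> \bar R)%E] <= n%:R * prob mu E.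
Proof.
move=> mE; elim: n => [|n IH].
  rewrite mul0r (_ : [set _ | _] = set0) /prob ?measure0//.
  apply/seteqP; split=> x //= /hit_leP[i]; lia.
rewrite -[in leRHS]natr1 mulrDl mul1r.
apply: le_trans (lerD IH (lexx _)).
rewrite -(prob_preimage_iter mu T mpT n.+1 E mE); apply: prob_subsetU.
- exact: measurable_hit_le.
- exact: measurable_hit_le.
- exact: (measurable_preimage_iter T mpT.1).
move=> x /= /hit_leP[i /andP[i0 ni] Ei].
have [in1|in1] := leqP i n; first by left; apply/hit_leP; exists i; rewrite ?i0.
by right; move: Ei; have -> : i = n.+1 by lia.
Qed.

(** A point of [A] that is outside [A] at time [j] leaves it at some step before; by invariance each
    step costs the same probability. *)
Lemma prob_setD_iter A j : measurable A ->
  prob mu (A `\` iter j T @^-1` A) <= j%:R * prob mu (A `\` T @^-1` A).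
Proof.
move=> mA; have mi n B : measurable B -> measurable (iter n T @^-1` B).
  exact: (measurable_preimage_iter T mpT.1).
have mD : measurable (A `\` T @^-1` A) by apply: measurableD => //; exact: (mi 1%N).
elim: j => [|j IH].
  rewrite mul0r (_ : _ `\` _ = set0) /prob ?measure0//.
  by apply/seteqP; split=> x //= [].
rewrite -[in leRHS]natr1 mulrDl mul1r; apply: le_trans (lerD IH (lexx _)).
rewrite -(prob_preimage_iter mu T mpT j _ mD); apply: prob_subsetU.
- by apply: measurableD => //; exact: mi.
- by apply: measurableD => //; exact: mi.
- exact: mi.
move=> x [Ax nAx]; have [Ajx|nAjx] := pselect ((iter j T @^-1` A) x); last by left.
by right.
Qed.

Hypothesis erT : ergodic mu T.

(* Averaging mu(Z & A_k) over the first n iterates turns the indicator of Z into its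
   mean mu(Z), while the almost invariant events A_k hardly change. *)
Lemma asymptotic_independence_lower (A : nat -> set X) Z :
  (forall k, measurable (A k)) -> measurable Z ->
  mu (A k `\` T @^-1` A k) @[k --> \oo] --> 0%E ->
  forall eps, 0 < eps -> \forall k \near \oo,
    prob mu Z * prob mu (A k) - eps < prob mu (Z `&` A k).
Proof.
(* The losses are one [e] for the visit frequency, one for the exceptional set [B] and one for the
   failure of invariance; the fourth gives strictness. *)
move=> mA mZ A0 eps eps0; pose e := eps / 4.
have e0 : 0 < e by rewrite /e; lra.
have mi n B : measurable B -> measurable (iter n T @^-1` B).
  exact: (measurable_preimage_iter T mpT.1).
have mD k : measurable (A k `\` T @^-1` A k).
  by apply: measurableD => //; exact: (mi 1%N).
have [n [n0 hn]] : exists n, (0 < n)%N /\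
    prob mu [set x | (visits T Z n x)%:R < n%:R * (prob mu Z - e)] < e.
  have [N _ hN] := visits_lower mu T mpT erT Z e mZ e0 e e0.
  by exists N.+1; split => //; apply: hN => /=.
set B := [set x | _] in hn.
have mB : measurable B.
  exact: (measurable_visits T mpT.1 Z n (fun v => v%:R < n%:R * (prob mu Z - e))).
have nR0 : 0 < n%:R :> R by rewrite ltr0n.
(* The length [n] is fixed before [k], so the defect of invariance accumulated over [n] iterates can
   be made smaller than [e]. *)
have en0 : 0 < e / n%:R by rewrite divr_gt0.
apply: filterS ((cvg_prob0P mu _ mD).1 A0 _ en0) => k; rewrite ltr_pdivlMr// => hk.
have p1 := prob_le1 mu _ (mA k); have p0 := prob_ge0 mu (A k).
have z0 := prob_ge0 mu Z; have z1 := prob_le1 mu _ mZ.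
(* For [prob mu Z <= e] the lower bound is negative; otherwise [prob mu Z - e] is positive and can
   be cancelled or multiplied. *)
have [ze|ze] := leP (prob mu Z) e.
  have := prob_ge0 mu (Z `&` A k); have : prob mu Z * prob mu (A k) <= prob mu Z.
    by rewrite ler_piMr.
  rewrite /e in ze; lra.
have mAB : measurable (A k `\` B) by exact: measurableD.
have K0 : 0 <= n%:R * (prob mu Z - e) by rewrite mulr_ge0//; lra.
have := le_sum_visits mu T mpT _ n _ _ K0 mAB mZ.
have KB x : (A k `\` B) x -> n%:R * (prob mu Z - e) <= (visits T Z n x)%:R.
  by move=> [_ /negP]; rewrite -leNgt.
move=> /(_ KB) h.
have AB : prob mu (A k) - e <= prob mu (A k `\` B).
  have := prob_setDI mu _ _ (mA k) mB.
  have : prob mu (A k `&` B) <= prob mu B.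
    by apply: prob_subset => //; exact: measurableI.
  lra.
have : \sum_(j < n) prob mu ((A k `\` B) `&` iter j T @^-1` Z) <=
       \sum_(j < n) (prob mu (Z `&` A k) + e).
  apply: ler_sum => j _.
  have mZA : measurable (Z `&` A k) by exact: measurableI.
  rewrite -(prob_preimage_iter mu T mpT j _ mZA).
  apply: (@le_trans _ _ (prob mu (iter j T @^-1` (Z `&` A k)) +
                        prob mu (A k `\` iter j T @^-1` A k))).
    apply: prob_subsetU.
    - by apply: measurableI => //; exact: mi.
    - exact: mi.
    - by apply: measurableD => //; exact: mi.
    move=> x [[Ax _] Zx].
    have [Ajx|nAjx] := pselect ((iter j T @^-1` A k) x); first by left.
    by right.
  rewrite lerD2l; apply: le_trans (prob_setD_iter (A k) j (mA k)) _.
  have jn : j%:R <= n%:R :> R by rewrite ler_nat ltnW.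
  have := prob_ge0 mu (A k `\` T @^-1` A k); nra.
rewrite sumr_const card_ord -[X in _ <= X]mulr_natl => h2.
have := le_trans h h2; rewrite -mulrA ler_pM2l// => h3.
have : (prob mu Z - e) * (prob mu (A k) - e) <= (prob mu Z - e) * prob mu (A k `\` B).
  by rewrite ler_pM2l// subr_gt0.
have : (prob mu Z - e) * (prob mu (A k) - e) =
  prob mu Z * prob mu (A k) - e * (prob mu Z + prob mu (A k)) + e * e by ring.
have : e * (prob mu Z + prob mu (A k)) <= e * 2 by rewrite ler_pM2l//; lra.
have : 0 < e * e by rewrite mulr_gt0.
have : eps = 4 * e by rewrite /e; lra.
move=> ->; lra.
Qed.

(** The lower bound for the complement of [Z] is the upper bound for [Z], since the two
    intersections with [A k] add up to [A k]. *)
Lemma asymptotic_independence (A : nat -> set X) Z :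
  (forall k, measurable (A k)) -> measurable Z ->
  mu (A k `\` T @^-1` A k) @[k --> \oo] --> 0%E ->
  forall eps, 0 < eps -> \forall k \near \oo,
    `|prob mu (Z `&` A k) - prob mu Z * prob mu (A k)| < eps.
Proof.
move=> mA mZ A0 eps eps0.
have h1 := asymptotic_independence_lower A Z mA mZ A0 eps eps0.
have h2 := asymptotic_independence_lower A (~` Z) mA (measurableC mZ) A0 eps eps0.
apply: filterS2 h1 h2 => k h1.
have := prob_setDI mu _ _ (mA k) mZ.
rewrite prob_setC// setDE [A k `&` Z]setIC [A k `&` ~` Z]setIC => h h2.
rewrite ltr_norml; apply/andP; split; move: h1 h2; rewrite h; lra.
Qed.

(** If [x] first hits at a time above 1, then [T x] hits one step sooner. The event can thus be lost
    only by a hit at time 1, that is on the preimage of [E]. *)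
Lemma scaled_hit_le_almost_invariant E c t : 0 <= c -> measurable E ->
  prob mu ([set x | (c%:E * hit T E x <= t%:E :> \bar R)%E] `\`
    T @^-1` [set x | (c%:E * hit T E x <= t%:E :> \bar R)%E]) <= prob mu E.
Proof.
move=> c0 mE; rewrite -(prob_preimage_iter mu T mpT 1 E mE).
have mS := measurable_scaled_hit_le T E c t mpT.1 mE.
apply: prob_subset.
- by apply: measurableD => //; exact: (measurable_preimage_iter T mpT.1 1).
- exact: (measurable_preimage_iter T mpT.1).
move=> x []; move: c0; rewrite le_eqVlt => /predU1P[<-|c0] /=.
  by rewrite /preimage/= !mul0e => ->.
move=> /(scaled_hit_leP _ _ _ _ _ c0)[[|[|i]] [// _ it Ei]] // nS; exfalso; apply: nS.
apply/scaled_hit_leP => //; exists i.+1; split => //; last by rewrite -iterSr.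
by apply: le_trans it; rewrite ler_pM2l// ler_nat.
Qed.

(** A point that never hits makes no visit to [E] from [T x] on, while by [visits_lower] long orbits
    with so few visits are arbitrarily improbable. *)
Lemma hit_infty_null E : measurable E -> (0 < mu E)%E ->
  mu [set x | hit T E x = +oo%E :> \bar R] = 0%E.
Proof.
move=> mE; rewrite (probE mu)// lte_fin => E0.
have mN : measurable [set x | hit T E x = +oo%E :> \bar R].
  have := measurable_hitn T mpT.1 E (fun o => (if o is Some n then n%:R%:E else +oo%E)= +oo%E :> \bar R) mE.
  by [].
rewrite (probE mu)//; congr (_%:E); apply/eqP; rewrite eq_le prob_ge0 andbT.
apply/ler_addgt0Pr => eps eps0; rewrite add0r.
have E2 : 0 < prob mu E / 2 by lra.
have [N _ /(_ N.+1 (leqnSn N))] := visits_lower mu T mpT erT E _ mE E2 eps eps0.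
set B := [set x | _]; move=> /= /ltW; apply: le_trans.
have mB : measurable B.
  exact: (measurable_visits T mpT.1 E N.+1 (fun v => v%:R < N.+1%:R * (prob mu E - prob mu E / 2))).
rewrite -(prob_preimage_iter mu T mpT 1 B mB); apply: prob_subset => //.
  exact: (measurable_preimage_iter T mpT.1).
move=> x /= xoo; rewrite /preimage/= /B/=.
case: (posnP (visits T E N.+1 (T x))) => [->|/(visits_gt0 T)[i _]].
  rewrite mulr_gt0 ?ltr0n//; lra.
rewrite -iterSr => Ei; have : (hit T E x <= i.+1%:R%:E :> \bar R)%E.
  by apply/hit_leP; exists i.+1; rewrite ?ltnSn.
by rewrite xoo leye_eq.
Qed.

(** A Markov-type bound, also a consequence of Kac's formula. Two visits to the set of long returns
    are more than [n] steps apart, so any [n.+1] consecutive times contain at most one, and the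
    complement is visited at least [n] times. *)
Lemma prob_return_gt A n : measurable A ->
  n.+1%:R * prob mu (A `&` [set x | (n%:R%:E < hit T A x :> \bar R)%E]) <= 1.
Proof.
move=> mA; set W := _ `&` _.
have mW : measurable W.
  apply: measurableI => //; rewrite -[X in measurable X]setTI.
  exact/emeasurable_fun_o_infty/measurable_hit/mA/mpT.1.
have vW : forall m x, (m <= n.+1)%N -> (visits T W m x <= 1)%N.
  elim=> [|m IH] x mn; first by rewrite visits0.
  rewrite visitsS; case: asboolP => [[Ax nx]|_]; last by rewrite add0n IH// ltnW.
  case: (posnP (visits T W m (T x))) => [->//|/(visits_gt0 T)[i im]].
  rewrite -iterSr => -[Ai _]; move: nx; rewrite /= ltNge => /negP; case.
  by apply/hit_leP; exists i.+1 => //; rewrite (leq_trans im).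
have : n%:R <= n.+1%:R * prob mu (~` W).
  apply: (le_visits mu T mpT) => //; first exact: measurableC.
  move=> x; rewrite ler_nat; have := visits_setC T W n.+1 x.
  have := vW n.+1 x (leqnn _); lia.
rewrite prob_setC// mulrBr mulr1 -natr1; lra.
Qed.

End HittingTimes.

(** * Transfer of convergence in law *)

Section Law.
Context {R : realType}.
Implicit Types (F : R -> R) (G H K : nat -> R -> R).

(** The jumps of a monotone function are countable, hence Lebesgue null, and cannot fill an interval
    of positive length. *)
Lemma nondecreasing_continuity_point F (a b : R) : {homo F : x y / x <= y} -> a < b ->
  exists s, a < s < b /\ {for s, continuous F}.
Proof.
move=> ndF ab; apply: contrapT => nex.
have Fab : {in `[a, b] &, nondecreasing_fun F} by move=> x y _ _; exact: ndF.
have := countable_lebesgue_measure0 (discontinuity_countable Fab).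
rewrite (_ : [set _ | _] = `]a, b[%classic).
  rewrite lebesgue_measure_itv/= lte_fin ab -EFinD => -[]; lra.
apply/seteqP; split=> [x []//|r rab]; split=> //.
have /andP[ar rb] : a < r < b by move: rab; rewrite /= in_itv/=.
have cl : cvg (F x @[x --> r^'-]).
  apply: nondecreasing_at_left_is_cvgr.
    by apply: nearW => x y z _ _; exact: ndF.
  apply: nearW => x; exists (F r) => _ [y + <-]; rewrite /= in_itv/= => /andP[_ /ltW].
  exact: ndF.
have cr : cvg (F x @[x --> r^'+]).
  apply: nondecreasing_at_right_is_cvgr.
    by apply: nearW => x y z _ _; exact: ndF.
  apply: nearW => x; exists (F r) => _ [y + <-]; rewrite /= in_itv/= => /andP[/ltW + _].
  exact: ndF.
(* Equal one-sided limits enclose [F r] by monotonicity, which makes [r] a continuity point. *)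
split => //; apply/eqP => lr; apply: nex; exists r; split; first by rewrite ar.
have l1 : lim (F x @[x --> r^'-]) <= F r.
  apply: limr_le => //; near=> x; apply: ndF; near: x; exact: nbhs_left_le.
have l2 : F r <= lim (F x @[x --> r^'+]).
  apply: limr_ge => //; near=> x; apply: ndF; near: x; exact: nbhs_right_ge.
apply/left_right_continuousP; split.
  have -> : F r = lim (F x @[x --> r^'-]) by apply/eqP; rewrite eq_le l1 andbT lr.
  exact: cl.
have -> : F r = lim (F x @[x --> r^'+]) by apply/eqP; rewrite eq_le l2/= -lr.
exact: cr.
Unshelve. all: by end_near. Qed.

(** One half of closeness in the Lévy metric, pointwise in [t]; the shift in the argument absorbs
    small perturbations of the random variables. *)
Definition asymptotically_below G H := forall t eps, 0 < eps ->
  \forall k \near \oo, G k t <= H k (t + eps) + eps.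

Lemma asymptotically_below_trans G H K :
  asymptotically_below G H -> asymptotically_below H K -> asymptotically_below G K.
Proof.
move=> GH HK t eps eps0; have e2 : 0 < eps / 2 by lra.
apply: filterS2 (GH t _ e2) (HK (t + eps / 2) _ e2) => k.
have -> : t + eps / 2 + eps / 2 = t + eps by lra.
lra.
Qed.

(** [H k t] is squeezed between the values of [G k] at continuity points [s0 < t < s1] of [F],
    chosen so close to [t] that [F] varies by less than [e / 3]. *)
Lemma asymptotically_close_cvg F G H :
  {homo F : x y / x <= y} -> (forall k, {homo G k : x y / x <= y}) ->
  asymptotically_below G H -> asymptotically_below H G ->
  (forall t, {for t, continuous F} -> G k t @[k --> \oo] --> F t) ->
  forall t, {for t, continuous F} -> H k t @[k --> \oo] --> F t.
Proof.
move=> ndF ndG GH HG GF t Ft; apply/cvgrPdist_le => e e0.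
have e3 : 0 < e / 3 by lra.
have /cvgrPdist_lt/(_ _ e3) := Ft => -[delta /= delta0 hd].
have [s1 [/andP[ts1 s1d] Fs1]] : exists s, t < s < t + delta /\ {for s, continuous F}.
  by apply: nondecreasing_continuity_point => //; lra.
have [s0 [/andP[ds0 s0t] Fs0]] : exists s, t - delta < s < t /\ {for s, continuous F}.
  by apply: nondecreasing_continuity_point => //; lra.
have d1 : `|F t - F s1| < e / 3 by apply: hd; rewrite /= ltr_norml; lra.
have d0 : `|F t - F s0| < e / 3 by apply: hd; rewrite /= ltr_norml; lra.
(* The shifts must not pass [s1] and [s0], and their additive errors must stay within [e / 3]. *)
pose e1 := Num.min (s1 - t) (e / 3); pose e0' := Num.min (t - s0) (e / 3).
have e1_gt0 : 0 < e1 by rewrite lt_min; lra.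
have e0_gt0 : 0 < e0' by rewrite lt_min; lra.
have [e1a e1b] : e1 <= s1 - t /\ e1 <= e / 3 by split; rewrite ge_min lexx ?orbT.
have [e0a e0b] : e0' <= t - s0 /\ e0' <= e / 3 by split; rewrite ge_min lexx ?orbT.
near=> k.
have h1 : H k t <= G k (t + e1) + e1 by near: k; exact: HG.
have h0 : G k (t - e0') <= H k (t - e0' + e0') + e0' by near: k; exact: GH.
rewrite subrK in h0.
have g1 : G k (t + e1) <= G k s1 by apply: ndG; lra.
have g0 : G k s0 <= G k (t - e0') by apply: ndG; lra.
have c1 : `|F s1 - G k s1| < e / 3.
  by near: k; move: (GF s1 Fs1) => /cvgrPdist_lt; exact.
have c0 : `|F s0 - G k s0| < e / 3.
  by near: k; move: (GF s0 Fs0) => /cvgrPdist_lt; exact.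
move: d1 d0 c1 c0; rewrite !ltr_norml ler_norml => /andP[? ?] /andP[? ?] /andP[? ?] /andP[? ?].
apply/andP; split; lra.
Unshelve. all: by end_near. Qed.

End Law.

Section LawOfEvents.
Context {R : realType} {d : measure_display} {X : measurableType d}.
Context {d' : measure_display} {Om : measurableType d'}.

Lemma cvg_lawP (nu : set X -> \bar R) (f : nat -> X -> \bar R) (G : nat -> R -> R)
    (P : probability Om R) (V : Om -> \bar R) :
  measurable_fun setT V ->
  (forall k t, nu [set x | (f k x <= t%:E)%E] = (G k t)%:E) ->
  cvg_law nu f P V <->
  (forall t, {for t, continuous (fun s => prob P [set w | (V w <= s%:E)%E])} ->
     G k t @[k --> \oo] --> prob P [set w | (V w <= t%:E)%E]).
Proof.
move=> mV nuG.
have eP t : P [set w | (V w <= t%:E)%E] = (prob P [set w | (V w <= t%:E)%E])%:E.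
  apply: probE; rewrite -[X in measurable X]setTI; exact: emeasurable_fun_infty_c.
have eG t : (fun k => nu [set x | (f k x <= t%:E)%E]) = (fun k => (G k t)%:E).
  by apply/funext => k.
split=> h t ct; have := h t ct; rewrite eG eP; first by move=> /fine_cvgP[].
by move=> hG; apply/fine_cvgP; split; [exact: nearW|].
Qed.

Lemma prob_le_nondecreasing (P : probability Om R) (V : Om -> \bar R) :
  measurable_fun setT V ->
  {homo (fun s : R => prob P [set w | (V w <= s%:E)%E]) : x y / x <= y}.
Proof.
move=> mV s t st.
have mVs (r : R) : measurable [set w | (V w <= r%:E)%E].
  rewrite -[X in measurable X]setTI; exact: emeasurable_fun_infty_c.
apply: prob_subset => // w /= /le_trans; apply; by rewrite lee_fin.
Qed.

End LawOfEvents.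

(** * The gap between the two hitting times *)

Section Conditional.
Context {R : realType} {d : measure_display} {X : measurableType d}.
Variables (mu : probability X R) (Y : set X).
Hypotheses (mY : measurable Y) (Y0 : 0 < prob mu Y).

Lemma condmE A : measurable A -> condm mu Y A = (prob mu (Y `&` A) / prob mu Y)%:E.
Proof. by move=> mA; rewrite /condm (probE mu _ (measurableI _ _ mY mA)). Qed.

Lemma cvg_meas0_condmP (g : nat -> X -> \bar R) :
  (forall k, measurable_fun setT (g k)) ->
  cvg_meas0 (condm mu Y) g <->
  (forall eps delta, 0 < eps -> 0 < delta -> \forall k \near \oo,
     prob mu (Y `&` [set x | (eps%:E < `|g k x|)%E]) < delta).
Proof.
move=> mg.
have mA eps k : measurable [set x | (eps%:E < `|g k x|)%E].
  rewrite -[X in measurable X]setTI.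
  by apply: emeasurable_fun_o_infty => //; exact: measurableT_comp.
have mYA eps k := measurableI _ _ mY (mA eps k).
split=> h eps.
  move=> delta eps0 delta0; have dY : 0 < delta / prob mu Y by rewrite divr_gt0.
  have := h eps eps0; under eq_fun => k do rewrite condmE//.
  move=> /fine_cvgP[_ /cvgr0Pnorm_lt/(_ _ dY)]; apply: filterS => k /=.
  by rewrite ger0_norm ?divr_ge0 ?prob_ge0// ltr_pM2r ?invr_gt0.
move=> eps0; under eq_fun => k do rewrite condmE//.
apply/fine_cvgP; split; first exact: nearW.
apply/cvgr0Pnorm_lt => delta delta0.
have dY : 0 < delta * prob mu Y by rewrite mulr_gt0.
apply: filterS (h eps _ eps0 dY) => k /=.
by rewrite ger0_norm ?divr_ge0 ?prob_ge0// ltr_pdivrMr.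
Qed.

Lemma asymptotically_below_condm (A B : nat -> R -> set X) :
  (forall t eps delta, 0 < eps -> 0 < delta -> \forall k \near \oo,
     prob mu (Y `&` A k t) <= prob mu (Y `&` B k (t + eps)) + delta) ->
  asymptotically_below (fun k t => prob mu (Y `&` A k t) / prob mu Y)
    (fun k t => prob mu (Y `&` B k t) / prob mu Y).
Proof.
move=> h t eps eps0; have eY : 0 < eps * prob mu Y by rewrite mulr_gt0.
apply: filterS (h t eps _ eps0 eY) => k hk.
by rewrite ler_pdivrMr// mulrDl divfK ?gt_eqF.
Qed.

End Conditional.

Lemma scaled_hit_close {R : realType} {X : Type} (f : X -> X) (A B : set X) x
    (c t eps : R) : 0 <= c -> 0 <= eps ->
  (`|c%:E * (hit f A x - hit f B x)| <= eps%:E)%E ->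
  ((c%:E * hit f A x <= t%:E)%E -> (c%:E * hit f B x <= (t + eps)%:E)%E) /\
  ((c%:E * hit f B x <= t%:E)%E -> (c%:E * hit f A x <= (t + eps)%:E)%E).
Proof.
move=> c0 e0; have tt : (t%:E <= (t + eps)%:E)%E by rewrite lee_fin; lra.
move: c0; rewrite le_eqVlt => /predU1P[<- _|c0].
  by rewrite !mul0e; split=> /le_trans; exact.
(* If just one hitting time is infinite, the scaled gap is infinite as well, against the bound; if
   both are, neither event occurs. *)
have [[n _ ->]|->] := @hit_finP R _ f A x; have [[m _ ->]|->] := @hit_finP R _ f B x.
- rewrite -EFinB -!EFinM abse_EFin !lee_fin ler_norml => /andP[h1 h2].
  by split; lra.
- by rewrite addeC /= gt0_muleNy ?lte_fin.
- by rewrite /= gt0_muley ?lte_fin.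
- by rewrite gt0_muley ?lte_fin.
Qed.

(** * Consequences of a small gap, and a covering criterion for it *)

Section Gap.
Context {R : realType} {d : measure_display} {X : measurableType d}.
Variables (mu : probability X R) (T : X -> X).
Hypotheses (mpT : measure_preserving mu T) (erT : ergodic mu T).
Variables (E E' : nat -> set X) (Y : set X).
Hypotheses (mE : forall k, measurable (E k)) (mE' : forall k, measurable (E' k)).
Hypotheses (mY : measurable Y) (E'Y : forall k, E' k `<=` Y).
Hypothesis Y0 : 0 < prob mu Y.
Hypothesis E0 : mu (E k) @[k --> \oo] --> 0%E.

Let c k := prob mu (E' k).
Let g k x := (mu (E' k) * (hit T (E k) x - hit T (E' k) x))%E.

Let gE k x : g k x = ((c k)%:E * (hit T (E k) x - hit T (E' k) x))%E.
Proof. by rewrite /g (probE mu). Qed.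

Lemma measurable_hit_gap k : measurable_fun setT (g k).
Proof.
by apply/measurable_funeM/emeasurable_funB; apply: (measurable_hit T mpT.1).
Qed.

Let mG eps k : measurable [set x | (eps%:E < `|g k x|)%E].
Proof.
rewrite -[X in measurable X]setTI; apply: emeasurable_fun_o_infty => //.
by apply: measurableT_comp => //; exact: measurable_hit_gap.
Qed.

(** Suppose [c k >= delta]. A point of [E' k] either returns to [E' k] late, or hits [E k] early, or
    has hitting times differing by at least 1 and so a scaled gap of at least [delta]. Each case has
    probability below [delta / 4]. *)
Lemma prob_via_to0 : cvg_meas0 (condm mu Y) g -> mu (E' k) @[k --> \oo] --> 0%E.
Proof.
move=> /(cvg_meas0_condmP mu Y mY Y0 g measurable_hit_gap) hg.
apply/(cvg_prob0P mu E' mE') => delta delta0.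
(* This makes [1 / n.+1 < delta / 4], the bound of [prob_return_gt] for late returns. *)
pose n := (Num.truncn (4 / delta)).
have n4 : 4 / delta < n.+1%:R by exact: truncnS_gt.
have n1 : 1 < n.+1%:R * (delta / 4).
  move: n4; rewrite ltr_pdivrMr//; lra.
have n0 : 0 < n.+1%:R :> R by rewrite ltr0n.
have d2 : 0 < delta / 2 by lra.
have d4 : 0 < delta / 4 by lra.
have dn : 0 < delta / 4 / n.+1%:R by rewrite divr_gt0.
apply: filterS2 ((cvg_prob0P mu E mE).1 E0 _ dn) (hg _ _ d2 d4) => k hE hgk.
rewrite ltNge; apply/negP => ck.
have h1 := prob_return_gt mu T mpT (E' k) n (mE' k).
have h2 := prob_hit_le mu T mpT (E k) n (mE k).
set W := E' k `&` _ in h1; set H := [set x | _] in h2.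
have mW : measurable W.
  apply: measurableI => //; rewrite -[X in measurable X]setTI.
  exact/emeasurable_fun_o_infty/(measurable_hit T mpT.1)/mE'.
have mH : measurable H by exact: (measurable_hit_le mu T mpT).
have mGY := measurableI _ _ mY (mG (delta / 2) k).
have sub : E' k `<=` W `|` (H `|` (Y `&` [set x | ((delta / 2)%:E < `|g k x|)%E])).
  move=> x E'x.
  have [hn|hn] := leP (hit T (E' k) x : \bar R) n%:R%:E; last by left.
  have [hE'|hE'] := leP (hit T (E k) x : \bar R) n%:R%:E; first by right; left.
  right; right; split; first exact: E'Y E'x.
  rewrite /= gE; move: hn hE'.
  have [[m _ ->]|->] := @hit_finP R _ T (E' k) x => //.
  rewrite lee_fin ler_nat => mn.
  have c0 : 0 < c k by apply: lt_le_trans ck.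
  have [[p _ ->]|->] := @hit_finP R _ T (E k) x; last first.
    by move=> _; rewrite /= gt0_muley ?lte_fin// ltry.
  rewrite lte_fin ltr_nat => np.
  rewrite -EFinB -EFinM abse_EFin lte_fin.
  have pm : 1 <= p%:R - m%:R :> R.
    by rewrite lerBrDr addrC natr1 ler_nat (leq_ltn_trans mn).
  apply: lt_le_trans (ler_norm _).
  have : c k * 1 <= c k * (p%:R - m%:R) by rewrite ler_pM2l.
  rewrite /c in c0 *; lra.
have := prob_subsetU mu _ _ _ (mE' k) mW (measurableU _ _ mH mGY) sub.
have := prob_setU mu _ _ mH mGY.
have pW : prob mu W < delta / 4.
  by rewrite -(ltr_pM2l n0); lra.
have pH : prob mu H < delta / 4.
  apply: le_lt_trans h2 _; move: hE; rewrite ltr_pdivlMr// mulrC.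
  have := prob_ge0 mu (E k); rewrite -[in n.+1%:R]natr1; lra.
lra.
Qed.

(** From a typical point of [Y] outside [E' k], the orbit meets [E' k] no later than [E k], and
    [E k] at most [M] steps after that. The scaled gap is then at most a multiple of [c k], and
    [c k] itself tends to 0 by the cover. *)
Lemma gap_small_of_cover M :
  (forall k, (0 < mu (E k))%E) ->
  (forall k, reach_only_via mu T Y (E k) (E' k)) ->
  (forall k, E' k `<=` \bigcup_(m in `I_M.+1) (iter m T @^-1` E k)) ->
  cvg_meas0 (condm mu Y) g.
Proof.
move=> Epos reach cover.
apply/(cvg_meas0_condmP mu Y mY Y0 g measurable_hit_gap) => eps delta eps0 delta0.
have M0 : 0 < M.+1%:R :> R by rewrite ltr0n.
have cE k : c k <= M.+1%:R * prob mu (E k).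
  rewrite -natr1 mulrDl mul1r; apply: le_trans (lerD (prob_hit_le mu T mpT _ M (mE k)) (lexx _)).
  apply: prob_subsetU => //; first exact: (measurable_hit_le mu T mpT).
  move=> x /cover[[|m] /= mM Ex]; first by right.
  by left; apply/hit_leP; exists m.+1.
have c_lt e : 0 < e -> \forall k \near \oo, c k < e.
  move=> e0; have eM : 0 < e / M.+1%:R by rewrite divr_gt0.
  apply: filterS ((cvg_prob0P mu E mE).1 E0 _ eM) => k.
  rewrite ltr_pdivlMr// mulrC; exact: le_lt_trans.
have eM : 0 < eps / M.+1%:R by rewrite divr_gt0.
apply: filterS2 (c_lt _ eM) (c_lt _ delta0) => k ceps; apply: le_lt_trans.
have [N [mN N0 NP]] : mu.-negligible (~` [set x | forall n, Y x -> E k (iter n T x) ->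
     exists2 j, (j <= n)%N & E' k (iter j T x)]).
  exact: (ae_foralln (reach k)).
have mO : measurable [set x | hit T (E k) x = +oo%E :> \bar R].
  exact: (measurable_hitn T mpT.1 (E k) (fun o => (if o is Some n then n%:R%:E else +oo%E)= +oo%E :> \bar R)).
have O0 := hit_infty_null mu T mpT erT (E k) (mE k) (Epos k).
set O := [set x | _] in mO O0.
have := prob_subsetU mu (Y `&` [set x | (eps%:E < `|g k x|)%E]) _ _
  (measurableI _ _ mY (mG eps k)) (mE' k) (measurableU _ _ mN mO).
have pNO : prob mu (N `|` O) <= 0.
  by apply: le_trans (prob_setU mu _ _ mN mO) _; rewrite /prob N0 O0 addr0.
move=> h; have {h} := h _; rewrite -/(c k) => h; suff : prob mu (Y `&` [set x | (eps%:E < `|g k x|)%E]) <= c k + prob mu (N `|` O) by lra.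
apply: h => x [Yx /= gx].
(* Points of [E' k] go to the exceptional set: for them the passage through [E' k] may be at time 0,
   which [hit] ignores. *)
have [E'x|nE'x] := pselect (E' k x); first by left.
right; have [Nx|nNx] := pselect (N x); [by left|right]; rewrite /O /=.
have hx : forall n, Y x -> E k (iter n T x) ->
     exists2 j, (j <= n)%N & E' k (iter j T x).
  by apply: contrapT => nh; apply: nNx; exact: NP.
move: gx; rewrite gE /hit.
case: (hitnP T (E k) x) => [n n0 En nmin|//].
have [[|j] jn E'j] := hx n Yx En; first by case: nE'x.
case: (hitnP T (E' k) x) => [p p0 E'p pmin|/(_ j.+1 isT)//].
have pn : (p <= n)%N by apply: leq_trans jn; exact: pmin.
(* The cover is applied at the first visit to [E' k], time [p], and yields a hit of [E k] at time
   [m + p]. *)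
have [m /= mM] := cover k _ E'p; rewrite /preimage/= -iterD => Emp.
have nmp : (n <= m + p)%N by apply: nmin => //; rewrite addn_gt0 p0 orbT.
rewrite lte_fin ltNge => /negP gx; exfalso; apply: gx.
have pnR : 0 <= n%:R - p%:R :> R by rewrite subr_ge0 ler_nat.
have nmR : n%:R - p%:R <= M.+1%:R :> R by rewrite lerBlDr -natrD ler_nat; lia.
have c0 : 0 <= c k by exact: prob_ge0.
rewrite ger0_norm ?mulr_ge0//.
move: ceps; rewrite ltr_pdivlMr// => /ltW; apply: le_trans.
exact: ler_wpM2l.
Qed.

End Gap.

(** * Comparison of the laws *)

(** A hit at time [i <= n] is an induced hit at the number of visits up to [i], which is at most
    that up to [n]. The tolerance is chosen so that scaling by [c / y] gives at most
    [t * (1 + eps / (t + 1)) <= t + eps]. *)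
Lemma scaled_hit_below {R : realType} {X : Type} (T : X -> X) (A Y : set X) x (c y t eps : R) :
  A `<=` Y -> 0 < c -> 0 < y -> 0 < eps ->
  (visits T Y (Num.truncn (t / c)) (T x))%:R <=
    (Num.truncn (t / c))%:R * (y + eps * y / (`|t| + 1)) ->
  (c%:E * hit T A x <= t%:E)%E ->
  ((c / y)%:E * hit (first_return T Y) A x <= (t + eps)%:E)%E.
Proof.
move=> AY c0 y0 eps0; set n := Num.truncn _ => vn.
move=> /(scaled_hit_leP _ _ _ _ _ c0)[i [i0 it Ai]].
have iR0 : 0 < i%:R :> R by rewrite ltr0n.
have t0 : 0 < t by apply: lt_le_trans it; rewrite mulr_gt0.
have tc0 : 0 <= t / c by rewrite divr_ge0// ltW.
have cn : c * n%:R <= t by rewrite mulrC -ler_pdivlMr// truncn_le.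
have iN : (i <= n)%N.
  by rewrite /n truncn_ge_nat// ler_pdivlMr// mulrC.
have [v0 vi] := iter_first_return_visits T Y i x i0 (AY _ Ai).
apply/scaled_hit_leP; first by rewrite divr_gt0.
exists (visits T Y i (T x)); split=> //; last by rewrite vi.
have vin : (visits T Y i (T x))%:R <= (visits T Y n (T x))%:R :> R.
  by rewrite ler_nat visits_mono.
rewrite ger0_norm in vn; last exact: ltW.
apply: (@le_trans _ _ (c / y * (n%:R * (y + eps * y / (t + 1))))).
  by rewrite ler_pM2l ?divr_gt0//; exact: le_trans vn.
have -> : c / y * (n%:R * (y + eps * y / (t + 1))) = c * n%:R * (1 + eps / (t + 1)).
  by field; rewrite !gt_eqF//; lra.
have h : 0 < 1 + eps / (t + 1) by rewrite addr_gt0// divr_gt0//; lra.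
apply: (@le_trans _ _ (t * (1 + eps / (t + 1)))); first by rewrite ler_pM2r.
rewrite mulrDr mulr1 lerD2l mulrCA ger_pMr// ler_pdivrMr; lra.
Qed.

(** Within [m] steps there are enough visits to contain all [j] returns. The condition
    [c <= eps / 2] absorbs the rounding, so [c * m >= t + eps / 2], and the tolerance costs at most
    the remaining [eps / 2]. *)
Lemma scaled_hit_above {R : realType} {X : Type} (T : X -> X) (A Y : set X) x (c y t eps : R) :
  0 < c -> 0 < y -> 0 < eps -> c <= eps / 2 ->
  (Num.truncn ((t + eps) / c))%:R * (y - eps * y / (2 * (`|t| + eps))) <=
    (visits T Y (Num.truncn ((t + eps) / c)) (T x))%:R ->
  ((c / y)%:E * hit (first_return T Y) A x <= t%:E)%E ->
  (c%:E * hit T A x <= (t + eps)%:E)%E.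
Proof.
move=> c0 y0 eps0 ceps; set m := Num.truncn _ => vm.
have cy0 : 0 < c / y by rewrite divr_gt0.
move=> /(scaled_hit_leP _ _ _ _ _ cy0)[j [j0 jt Aj]].
have jR0 : 0 < j%:R :> R by rewrite ltr0n.
have t0 : 0 < t by apply: lt_le_trans jt; rewrite mulr_gt0.
have tc0 : 0 <= (t + eps) / c by rewrite divr_ge0//; lra.
have cm : c * m%:R <= t + eps by rewrite mulrC -ler_pdivlMr// truncn_le.
have cm1 : t + eps / 2 <= c * m%:R.
  have : (t + eps) / c < m.+1%:R by exact: truncnS_gt.
  rewrite ltr_pdivrMr// -natr1 mulrDl mul1r; lra.
rewrite ger0_norm in vm; last exact: ltW.
have jm : (0 < j <= visits T Y m (T x))%N.
  rewrite j0 -(ler_nat R); apply: le_trans vm.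
  rewrite -(ler_pM2l cy0); apply: (le_trans jt).
  have -> : c / y * (m%:R * (y - eps * y / (2 * (t + eps)))) =
     c * m%:R * (1 - eps / (2 * (t + eps))) by field; rewrite !gt_eqF//; lra.
  have q1 : eps / (2 * (t + eps)) <= 1 by rewrite ler_pdivrMr; lra.
  apply: (@le_trans _ _ ((t + eps / 2) * (1 - eps / (2 * (t + eps))))); last first.
    by apply: ler_wpM2r => //; lra.
  have : (t + eps / 2) * (eps / (2 * (t + eps))) <= eps / 2.
    have -> : (t + eps / 2) * (eps / (2 * (t + eps))) = eps / 2 * ((t + eps / 2) / (t + eps)).
      by field; rewrite !gt_eqF//; lra.
    by rewrite ger_pMr; [rewrite ler_pdivrMr; lra|lra].
  lra.
have [i /andP[i0 im] ji] := iter_first_returnP T Y m j x jm.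
apply/scaled_hit_leP => //; exists i; split=> //; last by rewrite -ji.
by apply: le_trans cm; rewrite ler_pM2l// ler_nat.
Qed.

(** * From the induced law on Y to the law on the whole space *)

Section Laws.
Context {R : realType} {d : measure_display} {X : measurableType d}.
Variables (mu : probability X R) (T : X -> X).
Hypotheses (mpT : measure_preserving mu T) (erT : ergodic mu T).
Variables (E E' : nat -> set X) (Y : set X).
Hypotheses (mE : forall k, measurable (E k)) (mE' : forall k, measurable (E' k)).
Hypotheses (mY : measurable Y) (E'Y : forall k, E' k `<=` Y).
Hypothesis Y0 : 0 < prob mu Y.
Hypothesis E0 : mu (E k) @[k --> \oo] --> 0%E.
Hypothesis E'0 : mu (E' k) @[k --> \oo] --> 0%E.

Let c k := prob mu (E' k).
Let y := prob mu Y.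
(** The stages of the comparison are [A1] for induced hits of [E' k], [A2] for hits of [E' k] and
    [A3] for hits of [E k], all conditioned on [Y]; the last stage removes the conditioning from
    [A3]. *)
Let A1 k t := [set x | ((c k / y)%:E * hit (first_return T Y) (E' k) x <= t%:E)%E].
Let A2 k t := [set x | ((c k)%:E * hit T (E' k) x <= t%:E)%E].
Let A3 k t := [set x | ((c k)%:E * hit T (E k) x <= t%:E)%E].
Let cond (A : nat -> R -> set X) k t := prob mu (Y `&` A k t) / y.

Let mA1 k t : measurable (A1 k t).
Proof. apply: measurable_scaled_hit_le => //; exact: (measurable_first_return T mpT.1). Qed.

Let mA2 k t : measurable (A2 k t).
Proof. apply: measurable_scaled_hit_le => //; exact: mpT.1. Qed.

Let mA3 k t : measurable (A3 k t).
Proof. apply: measurable_scaled_hit_le => //; exact: mpT.1. Qed.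

Let c_small e : 0 < e -> \forall k \near \oo, c k < e.
Proof. exact: (cvg_prob0P mu E' mE').1. Qed.

(** As [c k] tends to 0 the time horizon grows, so the estimates on visits for large [n] apply.
    Where [c k = 0] the quotient is 0 by convention, hence the guard. *)
Let truncn_large t N : 0 < t -> \forall k \near \oo, 0 < c k -> (N <= Num.truncn (t / c k))%N.
Proof.
move=> t0; have tN : 0 < t / N.+1%:R by rewrite divr_gt0// ltr0n.
apply: filterS (c_small _ tN) => k ck c0.
rewrite truncn_ge_nat; last by rewrite divr_ge0// ltW.
rewrite ler_pdivlMr// ltW//.
move: ck; rewrite ltr_pdivlMr ?ltr0n// -natr1 mulrC; lra.
Qed.

Let prob_shift_visits n (P : nat -> Prop) :
  prob mu [set x | P (visits T Y n (T x))] = prob mu [set x | P (visits T Y n x)].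
Proof. exact: (prob_preimage_iter mu T mpT 1 _ (measurable_visits T mpT.1 Y n P mY)). Qed.

Let mYA A : measurable A -> measurable (Y `&` A).
Proof. exact: measurableI. Qed.

Let subset_close (A B : set X) delta : measurable A -> measurable B -> 0 < delta ->
  A `<=` B -> prob mu (Y `&` A) <= prob mu (Y `&` B) + delta.
Proof.
move=> mA mB delta0 AB; apply: (@le_trans _ _ (prob mu (Y `&` B))); last lra.
by apply: prob_subset; [exact: mYA|exact: mYA|exact: setIS].
Qed.

Let subsetU_close (A B D : set X) delta : measurable A -> measurable B ->
  measurable D -> prob mu D < delta ->
  A `<=` B `|` D -> prob mu (Y `&` A) <= prob mu (Y `&` B) + delta.
Proof.
move=> mA mB mD Ddelta AB.
apply: (@le_trans _ _ (prob mu (Y `&` B) + prob mu D)); last lra.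
apply: prob_subsetU => //; [exact: mYA|exact: mYA|].
by move=> x [Yx /AB[Bx|Dx]]; [left|right].
Qed.

Let scaled_hit_pos (S : X -> X) A x (b t : R) : 0 < b -> t <= 0 ->
  ~ (b%:E * hit S A x <= t%:E)%E.
Proof.
move=> b0 t0 /(scaled_hit_leP _ _ _ _ _ b0)[i [i0 it _]].
have : 0 < b * i%:R by rewrite mulr_gt0// ltr0n.
lra.
Qed.

Let measurable_shift_visits n (P : nat -> Prop) :
  measurable [set x | P (visits T Y n (T x))].
Proof.
exact: (measurable_preimage_iter T mpT.1 1 _ (measurable_visits T mpT.1 Y n P mY)).
Qed.

Lemma hit_below_return : asymptotically_below (cond A2) (cond A1).
Proof.
apply: (asymptotically_below_condm mu Y Y0) => t eps delta eps0 delta0.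
have eta0 : 0 < eps * y / (`|t| + 1) by rewrite divr_gt0 ?mulr_gt0 ?addr_ge0.
have [N _ hN] := visits_upper mu T mpT erT Y _ mY eta0 delta delta0.
have : \forall k \near \oo, 0 < t -> 0 < c k -> (N <= Num.truncn (t / c k))%N.
  have [t0|t0] := ltP 0 t; last by apply: nearW.
  by apply: filterS (truncn_large t N t0) => k hk _.
apply: filterS => k hk.
(* Two degenerate cases come first: for [c k = 0] both events reduce to a comparison of 0 with the
   level, and for [t <= 0] the first event is empty since hitting times are at least 1. *)
have := prob_ge0 mu (E' k); rewrite le_eqVlt -/(c k) => /predU1P[c0|c0].
  apply: subset_close => // x; rewrite /A2 /A1 /= -c0 mul0r !mul0e !lee_fin; lra.
have [t0|t0] := leP t 0.
  by apply: subset_close => // x /(scaled_hit_pos _ _ _ _ _ c0 t0).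
set n := Num.truncn (t / c k) in hk.
pose P v : Prop := n%:R * (y + eps * y / (`|t| + 1)) < v%:R.
(* The inclusion of events may fail only where [Y] is visited too often up to time [n], a set of
   probability below [delta]. *)
apply: (@subsetU_close _ _ [set x | P (visits T Y n (T x))]) => //.
  by rewrite (prob_shift_visits n P); apply: hN; exact: hk.
move=> x A2x; rewrite /P.
have [bad|ok] := ltP (n%:R * (y + eps * y / (`|t| + 1))) (visits T Y n (T x))%:R.
  by right.
by left; apply: scaled_hit_below.
Qed.

Lemma return_below_hit : asymptotically_below (cond A1) (cond A2).
Proof.
apply: (asymptotically_below_condm mu Y Y0) => t eps delta eps0 delta0.
have eta0 : 0 < eps * y / (2 * (`|t| + eps)).
  by rewrite divr_gt0 ?mulr_gt0 ?ltr_wpDl.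
have [N _ hN] := visits_lower mu T mpT erT Y _ mY eta0 delta delta0.
have hc : \forall k \near \oo, 0 < t -> 0 < c k -> (N <= Num.truncn ((t + eps) / c k))%N.
  have [t0|t0] := ltP 0 t; last by apply: nearW.
  by apply: filterS (truncn_large (t + eps) N (addr_gt0 t0 eps0)) => k hk _.
have e2 : 0 < eps / 2 by lra.
apply: filterS2 hc (c_small _ e2) => k hk /ltW ceps.
have := prob_ge0 mu (E' k); rewrite le_eqVlt -/(c k) => /predU1P[c0|c0].
  apply: subset_close => // x; rewrite /A2 /A1 /= -c0 mul0r !mul0e !lee_fin; lra.
have [t0|t0] := leP t 0.
  have cy0 : 0 < c k / y by rewrite divr_gt0.
  by apply: subset_close => // x /(scaled_hit_pos _ _ _ _ _ cy0 t0).
set n := Num.truncn ((t + eps) / c k) in hk.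
pose P v : Prop := v%:R < n%:R * (y - eps * y / (2 * (`|t| + eps))).
(* Here the exceptional points are those with too few visits to [Y] up to time [n]. *)
apply: (@subsetU_close _ _ [set x | P (visits T Y n (T x))]) => //.
  by rewrite (prob_shift_visits n P); apply: hN; exact: hk.
move=> x A1x; rewrite /P.
have [bad|ok] := ltP (visits T Y n (T x))%:R (n%:R * (y - eps * y / (2 * (`|t| + eps)))).
  by right.
by left; apply: (@scaled_hit_above R X T (E' k) Y x (c k) y t eps).
Qed.

Hypothesis gap0 : cvg_meas0 (condm mu Y)
  (fun k x => (mu (E' k) * (hit T (E k) x - hit T (E' k) x))%E).

Lemma hit_via_close :
  asymptotically_below (cond A2) (cond A3) /\ asymptotically_below (cond A3) (cond A2).
Proof.
have mg := measurable_hit_gap mu T mpT E E' mE mE'.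
have gapP := (cvg_meas0_condmP mu Y mY Y0 _ mg).1 gap0.
have close k t eps x : 0 < eps ->
    ~ (eps%:E < `|mu (E' k) * (hit T (E k) x - hit T (E' k) x)|)%E ->
    (A3 k t x -> A2 k (t + eps) x) /\ (A2 k t x -> A3 k (t + eps) x).
  move=> eps0 /negP; rewrite -leNgt (probE mu)// => gx.
  by apply: scaled_hit_close gx; rewrite ?prob_ge0// ltW.
have mD eps k : measurable (Y `&`
    [set x | (eps%:E < `|mu (E' k) * (hit T (E k) x - hit T (E' k) x)|)%E]).
  apply: mYA; rewrite -[X in measurable X]setTI; apply: emeasurable_fun_o_infty => //.
  by apply: measurableT_comp => //; exact: mg.
have sub (A B : nat -> R -> set X) (mA : forall k t, measurable (A k t))
   (mB : forall k t, measurable (B k t)) :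
   (forall k t eps x, 0 < eps ->
     ~ (eps%:E < `|mu (E' k) * (hit T (E k) x - hit T (E' k) x)|)%E ->
     A k t x -> B k (t + eps) x) -> asymptotically_below (cond A) (cond B).
  move=> AB; apply: (asymptotically_below_condm mu Y Y0) => t eps delta eps0 delta0.
  apply: filterS (gapP _ _ eps0 delta0) => k hk.
  apply: le_trans (_ : prob mu (Y `&` B k (t + eps)) + prob mu _ <= _); last first.
    by rewrite lerD2l; exact: ltW hk.
  apply: prob_subsetU; [exact: mYA|exact: mYA|exact: mD|] => x [Yx Ax].
  have [gx|gx] := pselect
    (eps%:E < `|mu (E' k) * (hit T (E k) x - hit T (E' k) x)|)%E; first by right.
  by left; split=> //; exact: AB gx Ax.
by split; apply: sub => // k t eps x eps0 gx; have [] := close k t eps x eps0 gx.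
Qed.

(** The events [A3 k t] fail to be invariant by at most [prob mu (E k)], which tends to 0, so they
    become independent of [Y]. The comparison is at equal [t]; monotonicity supplies the shift. *)
Lemma hit_law_on_Y :
  asymptotically_below (cond A3) (fun k t => prob mu (A3 k t)) /\
  asymptotically_below (fun k t => prob mu (A3 k t)) (cond A3).
Proof.
suff h t eps : 0 < eps -> \forall k \near \oo, `|cond A3 k t - prob mu (A3 k t)| < eps.
  split=> t eps eps0; apply: filterS (h t eps eps0) => k; rewrite ltr_norml => /andP[].
    have : prob mu (A3 k t) <= prob mu (A3 k (t + eps)).
      by apply: prob_subset => // x /le_trans; apply; rewrite lee_fin; lra.
    lra.
  have : cond A3 k t <= cond A3 k (t + eps).
    rewrite ler_pM2r ?invr_gt0//; apply: prob_subset; [exact: mYA|exact: mYA|].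
    by apply: setIS => x /le_trans; apply; rewrite lee_fin; lra.
  lra.
move=> eps0; have eY : 0 < eps * y by rewrite mulr_gt0.
have inv : mu (A3 k t `\` T @^-1` A3 k t) @[k --> \oo] --> 0%E.
  apply/cvg_prob0P => [k|e e0].
    by apply: measurableD => //; exact: (measurable_preimage_iter T mpT.1 1).
  apply: filterS ((cvg_prob0P mu E mE).1 E0 e e0) => k; apply: le_lt_trans.
  by apply: scaled_hit_le_almost_invariant; rewrite ?prob_ge0.
have := asymptotic_independence mu T mpT erT (A3 ^~ t) Y (fun k => mA3 k t) mY inv _ eY.
apply: filterS => k.
have -> : cond A3 k t - prob mu (A3 k t) =
  (prob mu (Y `&` A3 k t) - y * prob mu (A3 k t)) / y.
  by rewrite /cond; field; rewrite gt_eqF.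
by rewrite normrM normfV (ger0_norm (ltW Y0)) ltr_pdivrMr.
Qed.

Lemma return_law_close :
  asymptotically_below (cond A1) (fun k t => prob mu (A3 k t)) /\
  asymptotically_below (fun k t => prob mu (A3 k t)) (cond A1).
Proof.
have [h23 h32] := hit_via_close; have [h3 h3'] := hit_law_on_Y; split.
  apply: asymptotically_below_trans h3.
  exact: asymptotically_below_trans return_below_hit h23.
apply: asymptotically_below_trans h3' _.
exact: asymptotically_below_trans h32 hit_below_return.
Qed.

Lemma return_law_cvg {d' : measure_display} {Om : measurableType d'}
    (P : probability Om R) (V : Om -> \bar R) : measurable_fun setT V ->
  cvg_law (condm mu Y)
    (fun k x => (condm mu Y (E' k) * hit (first_return T Y) (E' k) x)%E) P V <->
  cvg_law mu (fun k x => (mu (E' k) * hit T (E k) x)%E) P V.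
Proof.
move=> mV.
(* Since [E' k] lies in [Y], the normalization under [condm mu Y] is [c k / y], the factor in
   [A1]. *)
have cE k : condm mu Y (E' k) = (c k / y)%:E.
  by rewrite condmE// (setIidr (@E'Y k)).
rewrite (cvg_lawP _ _ (cond A1))//; last first.
  by move=> k t; rewrite cE; exact: (condmE mu Y mY _ (mA1 k t)).
rewrite (cvg_lawP _ _ (fun k t => prob mu (A3 k t)))//; last first.
  by move=> k t; rewrite (probE mu (E' k))//; exact: (probE mu _ (mA3 k t)).
have ndA1 k : {homo cond A1 k : s t / s <= t}.
  move=> s t st; rewrite ler_pM2r ?invr_gt0//.
  apply: prob_subset; [exact: mYA|exact: mYA|].
  by apply: setIS => x /le_trans; apply; rewrite lee_fin.
have ndA3 k : {homo (fun t => prob mu (A3 k t)) : s t / s <= t}.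
  by move=> s t st; apply: prob_subset => // x /le_trans; apply; rewrite lee_fin.
have ndP := prob_le_nondecreasing P V mV.
have [h13 h31] := return_law_close.
split=> h t; first exact: asymptotically_close_cvg ndP ndA1 h13 h31 h t.
exact: asymptotically_close_cvg ndP ndA3 h31 h13 h t.
Qed.

End Laws.

Theorem mainTheorem2 (R : realType) (d : measure_display) (X : measurableType d)
  (mu : probability X R) (T : X -> X)
  (E E' : nat -> set X) (Y : set X) :
  measure_preserving mu T -> ergodic mu T ->
  (forall k, measurable (E k)) -> (forall k, (0 < mu (E k))%E) ->
  (fun k => mu (E k)) @ \oo --> 0%E ->
  measurable Y -> (0 < mu Y)%E ->
  (forall k, measurable (E' k)) -> (forall k, E' k `<=` Y) ->
  (forall k, reach_only_via mu T Y (E k) (E' k)) ->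
  let g := fun k x => (mu (E' k) * (hit T (E k) x - hit T (E' k) x))%E in
  ((cvg_meas0 (condm mu Y) g ->
      (fun k => mu (E' k)) @ \oo --> 0%E /\
      forall (d' : measure_display) (Om : measurableType d')
             (P : probability Om R) (RV : Om -> \bar R),
        measurable_fun [set: Om] RV -> (forall w, (0 <= RV w)%E) ->
        (cvg_law (condm mu Y)
           (fun k x => (condm mu Y (E' k) * hit (first_return T Y) (E' k) x)%E) P RV
         <-> cvg_law mu (fun k x => (mu (E' k) * hit T (E k) x)%E) P RV))
   /\
   ((exists M : nat, forall k,
        E' k `<=` \bigcup_(m in `I_M.+1) (iter m T @^-1` E k)) ->
      cvg_meas0 (condm mu Y) g)).
Proof.
move=> mpT erT mE Epos E0 mY Ypos mE' E'Y reach g.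
have Y0 : 0 < prob mu Y by rewrite -lte_fin -probE.
split=> [gap|[M cover]]; last exact: (gap_small_of_cover mu T mpT erT E E' Y) cover.
have E'0 := prob_via_to0 mu T mpT E E' Y mE mE' mY E'Y Y0 E0 gap.
by split=> // d' Om P RV mRV _; apply: return_law_cvg.
Qed.
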